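(* Let $f,g:\mathbb{R}^n\to(-\infty,+\infty]$ be proper and lower semicontinuous, let $\mu>0$, and suppose that $\operatorname{argmin}f\cap\operatorname{argmin}g\neq\varnothing$ and $\alpha\in(0,1)$. Let $\varphi^{\alpha}_{\mu}=-e_{\mu}(-\alpha e_{\mu}f-(1-\alpha)e_{\mu}g)$. Then the following hold: (a) $\min(\alpha f+(1-\alpha)g)=\alpha\min f+(1-\alpha)\min g$, and $\operatorname{argmin}(\alpha f+(1-\alpha)g)=\operatorname{argmin}f\cap\operatorname{argmin}g$; (b) $\min\varphi^{\alpha}_{\mu}=\alpha\min f+(1-\alpha)\min g$, and $\operatorname{argmin}\varphi^{\alpha}_{\mu}=\operatorname{argmin}f\cap\operatorname{argmin}g$.
   Context: $\|\cdot\|$ is the Euclidean norm; $\min$ and $\operatorname{argmin}$ are over $\mathbb{R}^n$. For a proper function $f$ and $\mu>0$, $e_{\mu}f(x)=\inf_{w}\{f(w)+\frac{1}{2\mu}\|w-x\|^2\}$ is the Moreau envelope; $\varphi^\alpha_\mu$ is called the proximal average of $f$ and $g$. (The paper's standing assumption that $f,g$ are prox-bounded, i.e. $e_\lambda f(x)>-\infty$ for some $\lambda>0$ and $x$, holds automatically, with every $\mu>0$ admissible, since functions having minimizers are bounded below.) *)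

(* Defs.v *)
From mathcomp Require Import all_boot all_order all_algebra.
From mathcomp Require Import all_classical all_reals all_analysis.
Set Implicit Arguments.
Unset Strict Implicit.
Unset Printing Implicit Defensive.
Import Order.TTheory GRing.Theory Num.Theory.
Import numFieldNormedType.Exports.
Local Open Scope classical_set_scope.
Local Open Scope ring_scope.
Local Open Scope ereal_scope.

(* The library norm `|x| on 'rV[R]_n is the sup norm, hence this definition. *)
Definition enorm (R : realType) (n : nat) (x : 'rV[R]_n) : R :=
  Num.sqrt (\sum_(i < n) x ord0 i ^+ 2)%R.

Definition proper_fun (R : realType) (T : Type) (f : T -> \bar R) : Prop :=
  (forall x, -oo < f x) /\ (exists x, f x < +oo).

Definition argmin (R : realType) (T : Type) (f : T -> \bar R) : set T :=
  [set x | forall y, f x <= f y].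

(* The infimum; it is a minimum exactly when argmin f is nonempty. *)
Definition emin (R : realType) (T : Type) (f : T -> \bar R) : \bar R :=
  ereal_inf (range f).

Definition is_min (R : realType) (T : Type) (f : T -> \bar R) (m : \bar R) : Prop :=
  argmin f !=set0 /\ emin f = m.

Definition moreau (R : realType) (n : nat) (mu : R) (f : 'rV[R]_n -> \bar R)
    (x : 'rV[R]_n) : \bar R :=
  ereal_inf (range (fun w => f w + ((2 * mu)^-1 * enorm (w - x) ^+ 2)%:E)).

Definition wsum (R : realType) (T : Type) (a : R) (f g : T -> \bar R) (x : T)
    : \bar R :=
  a%:E * f x + (1 - a)%:E * g x.

(* For proper f, g bounded below and 0 <= alpha <= 1, both envelopes are
   finite, so no indeterminate form of extended-real arithmetic occurs. *)
Definition prox_avg (R : realType) (n : nat) (mu alpha : R)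
    (f g : 'rV[R]_n -> \bar R) (x : 'rV[R]_n) : \bar R :=
  - moreau mu (fun w => - (alpha%:E * moreau mu f w)
                        - (1 - alpha)%:E * moreau mu g w) x.

(* Main.v *)
(* Write h for the weighted sum of the two envelopes, m for the weighted sum of
   the two minima.  Since the proximal average is
   sup_w (h w - |w - x|^2 / (2 mu)), taking w := x gives prox_avg >= h >= m, and
   at a common minimizer z the bound e_mu f w <= f z + |w - z|^2 / (2 mu) gives
   prox_avg z <= m.  Conversely, prox_avg x <= m forces e_mu f x = min f and
   e_mu g x = min g; then points w with f w close to min f lie arbitrarily close
   to x, and lower semicontinuity gives f x = min f (and likewise for g). *)
Require Import Defs.
From mathcomp Require Import all_boot all_order all_algebra.
From mathcomp Require Import all_classical all_reals all_analysis.
From mathcomp Require Import lra.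
Import Order.TTheory GRing.Theory Num.Theory.
Import numFieldNormedType.Exports.
Local Open Scope classical_set_scope.
Local Open Scope ring_scope.
Local Open Scope ereal_scope.

Lemma enorm0 {R : realType} {n : nat} : enorm (0 : 'rV[R]_n) = 0%R.
Proof.
by rewrite /enorm big1 ?sqrtr0// => i _; rewrite mxE expr0n.
Qed.

Lemma enormB {R : realType} {n : nat} (x y : 'rV[R]_n) :
  enorm (x - y) = enorm (y - x).
Proof.
congr Num.sqrt; apply: eq_bigr => i _.
by rewrite !mxE -sqrrN opprB.
Qed.

Lemma sqr_coord_le_enorm {R : realType} {n : nat} (x : 'rV[R]_n) i :
  (x ord0 i ^+ 2 <= enorm x ^+ 2)%R.
Proof.
rewrite sqr_sqrtr; last by apply: sumr_ge0 => j _; exact: sqr_ge0.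
by rewrite (bigD1 i)//= lerDl sumr_ge0// => j _; exact: sqr_ge0.
Qed.

(** No coordinate exceeds the Euclidean norm in absolute value. This carries smallness of the
    quadratic penalty over to the sup-norm balls in which lower semicontinuity is used. *)
Lemma ball_enorm {R : realType} {n : nat} (x y : 'rV[R]_n) (d : R) :
  (0 < d)%R -> (enorm (y - x) ^+ 2 < d ^+ 2)%R -> ball x d y.
Proof.
move=> d0 yx; split=> // i j; rewrite (ord1 i).
have := le_lt_trans (sqr_coord_le_enorm (y - x) j) yx.
rewrite -[X in (X < _)%R]real_normK ?num_real// ltr_pXn2r ?nnegrE ?normr_ge0 ?(ltW d0)//.
by rewrite !mxE /ball /= distrC.
Qed.

Lemma emin_argmin {R : realType} {T : Type} (f : T -> \bar R) z :
  argmin f z -> emin f = f z.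
Proof.
move=> fz; apply/eqP; rewrite eq_le; apply/andP; split.
  by apply: ereal_inf_lbound; exists z.
by apply: le_ereal_inf_tmp => _ [x _ <-]; exact: fz.
Qed.

Lemma fin_num_argmin {R : realType} {T : Type} (f : T -> \bar R) z :
  proper_fun f -> argmin f z -> f z \is a fin_num.
Proof.
move=> [fNy [x fxy]] fz; rewrite fin_numElt fNy /=.
exact: le_lt_trans (fz x) fxy.
Qed.

Lemma argmin_le {R : realType} {T : Type} (f : T -> \bar R) z x :
  argmin f z -> f x <= f z -> argmin f x.
Proof. by move=> fz fxz y; exact: le_trans fxz (fz y). Qed.

(** Common frame for both halves of the theorem: a lower bound [m] that is reached is the minimum,
    so the minimizers form the sublevel set at level [m]. *)
Lemma is_min_sublevel {R : realType} {T : Type} (F : T -> \bar R) (m : \bar R)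
    (A : set T) :
  A !=set0 -> (forall x, m <= F x) -> (forall x, F x <= m <-> A x) ->
  is_min F m /\ argmin F = A.
Proof.
move=> [z Az] mF FA.
have Fz : F z = m by apply/eqP; rewrite eq_le mF andbT; apply/FA.
have minz : argmin F z by move=> y; rewrite Fz.
split; first by split; [exists z | rewrite (emin_argmin _ _ minz)].
apply/seteqP; split=> x.
  by move=> Fx; apply/FA; rewrite -Fz.
by move=> /FA Fxm y; exact: le_trans Fxm (mF y).
Qed.

Lemma wsum_ge {R : realType} {T : Type} (f g : T -> \bar R) (a : R) (x : T)
    (p q : \bar R) :
  (0 < a)%R -> (a < 1)%R -> p <= f x -> q <= g x ->
  a%:E * p + (1 - a)%:E * q <= wsum a f g x.
Proof.
move=> a0 a1 pf qg; apply: leeD; apply: lee_wpmul2l => //.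
  by rewrite lee_fin ltW.
by rewrite lee_fin subr_ge0 ltW.
Qed.

(** Both weights are strictly positive, so an excess in one summand cannot be offset by the other,
    which is already at least its bound. A value [+oo] would make the whole sum [+oo]. *)
Lemma wsum_leP {R : realType} {T : Type} (f g : T -> \bar R) (a : R) (x : T)
    (p q : \bar R) :
  (0 < a)%R -> (a < 1)%R -> p \is a fin_num -> q \is a fin_num ->
  p <= f x -> q <= g x ->
  wsum a f g x <= a%:E * p + (1 - a)%:E * q -> f x <= p /\ g x <= q.
Proof.
move=> a0 a1; have b0 : (0 < 1 - a)%R by rewrite subr_gt0.
rewrite /wsum; move: p q (f x) (g x) => [p| |] [q| |] // [u| |] [v| |] //= _ _.
- rewrite !lee_fin => pu qv h.
  have hu : (a * p <= a * u)%R by rewrite ler_pM2l.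
  have hv : ((1 - a) * q <= (1 - a) * v)%R by rewrite ler_pM2l.
  split; first by rewrite -(ler_pM2l a0); lra.
  by rewrite -(ler_pM2l b0); lra.
- by rewrite (gt0_muley (x := (1 - a)%:E)) ?lte_fin.
- by rewrite (gt0_muley (x := a%:E)) ?lte_fin.
- by rewrite !gt0_muley ?lte_fin.
Qed.

Section Moreau.
Context {R : realType} {n : nat} (mu : R) (mu_gt0 : (0 < mu)%R).
Implicit Types (f g : 'rV[R]_n -> \bar R) (w x z : 'rV[R]_n).

Let c_gt0 : (0 < (2 * mu)^-1)%R.
Proof. by rewrite invr_gt0 mulr_gt0. Qed.

Lemma moreau_le f x w :
  moreau mu f x <= f w + ((2 * mu)^-1 * enorm (w - x) ^+ 2)%:E.
Proof. by apply: ereal_inf_lbound; exists w. Qed.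

Lemma moreau_le_id f x : moreau mu f x <= f x.
Proof.
by have := moreau_le f x x; rewrite subrr enorm0 expr0n mulr0 adde0.
Qed.

Lemma moreau_ge_argmin f z x : argmin f z -> f z <= moreau mu f x.
Proof.
move=> fz; apply: le_ereal_inf_tmp => _ [w _ <-].
rewrite -[leLHS]adde0; apply: leeD; first exact: fz.
by rewrite lee_fin mulr_ge0 ?sqr_ge0 ?ltW.
Qed.

Lemma fin_num_moreau f z x :
  argmin f z -> f z \is a fin_num -> moreau mu f x \is a fin_num.
Proof.
move=> fz fin; rewrite fin_numElt; apply/andP; split.
  by apply: lt_le_trans (moreau_ge_argmin f z x fz); rewrite ltNye_eq fin.
by apply: le_lt_trans (moreau_le f x z) _; rewrite lte_add_pinfty ?ltry// ltey_eq fin.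
Qed.

Lemma moreau_le_argmin f z x : lower_semicontinuous f ->
  argmin f z -> f z \is a fin_num -> moreau mu f x <= f z -> argmin f x.
Proof.
move=> lsc fz fin efx; apply: (argmin_le f z) => //; rewrite leNgt.
apply/negP => fzx.
have fzE := fineK fin; set a := fine (f z) in fzE.
have [r ar rfx] : exists2 r : R, (a < r)%R & r%:E < f x.
  move: fzx; rewrite -fzE; case: (f x) => [b| |] //.
    rewrite lte_fin => ab; exists ((a + b) / 2)%R; first by rewrite midf_lt.
    by rewrite lte_fin midf_lt.
  by move=> _; exists (a + 1)%R; rewrite ?ltrDl// ltry.
have [V /nbhs_ballP[d /= d0 dV] rV] := lsc _ _ rfx.
(* A point [w] within [e] of the infimum has penalty below [e], since [f w] is at least [a]; the
   second bound then puts [w] in the ball where [f] exceeds [r]. The first bound gives [f w < r], a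
   contradiction. *)
pose e := Num.min (r - a)%R ((2 * mu)^-1 * d ^+ 2)%R.
have e0 : (0 < e)%R by rewrite lt_min subr_gt0 ar mulr_gt0// exprn_gt0.
have : moreau mu f x < (a + e)%:E.
  by apply: le_lt_trans efx _; rewrite -fzE lte_fin ltrDl.
move=> /ereal_inf_ltP[_ [w _ <-]].
have := fz w; rewrite -fzE; case E : (f w) => [b| |] //.
rewrite -EFinD lee_fin lte_fin => ab bw.
have q0 : (0 <= (2 * mu)^-1 * enorm (w - x) ^+ 2)%R.
  by rewrite mulr_ge0 ?sqr_ge0 ?ltW.
have er : (e <= r - a)%R by rewrite ge_min lexx.
have ed : (e <= (2 * mu)^-1 * d ^+ 2)%R by rewrite ge_min lexx orbT.
have : V w by apply/dV/ball_enorm => //; rewrite -(ltr_pM2l c_gt0); lra.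
by move/rV; rewrite E lte_fin; lra.
Qed.

Lemma prox_avg_ge_wsum_moreau (a : R) f g z x :
  argmin f z -> argmin g z -> f z \is a fin_num -> g z \is a fin_num ->
  wsum a (moreau mu f) (moreau mu g) x <= prox_avg mu a f g x.
Proof.
move=> fz gz ffin gfin; rewrite /prox_avg leeNr.
apply: le_trans (moreau_le_id _ x) _.
have [F G] := (fin_num_moreau f z x fz ffin, fin_num_moreau g z x gz gfin).
(* Finiteness of the envelopes lets negation distribute over the sum. *)
by rewrite /wsum fin_num_oppeD// fin_numM.
Qed.

Lemma prox_avg_le_wsum_argmin (a : R) f g z :
  (0 < a)%R -> (a < 1)%R ->
  argmin f z -> argmin g z -> f z \is a fin_num -> g z \is a fin_num ->
  prox_avg mu a f g z <= wsum a f g z.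
Proof.
move=> a0 a1 fz gz ffin gfin; rewrite /prox_avg leeNl.
apply: le_ereal_inf_tmp => _ [w _ <-].
move: (moreau_le f w z) (moreau_le g w z).
(* By symmetry of the norm the same penalty [t] occurs in both envelope bounds and in the outer
   infimum. The weights sum to 1, so averaging the two bounds adds exactly [t], which the outer
   penalty cancels. *)
rewrite /wsum (enormB z w).
rewrite -(fineK (fin_num_moreau f z w fz ffin)).
rewrite -(fineK (fin_num_moreau g z w gz gfin)) -(fineK ffin) -(fineK gfin).
move: (fine _) (fine _) (fine _) (fine _) ((2 * mu)^-1 * _)%R => q G p F t.
rewrite -!EFinM -!EFinN -!EFinD !lee_fin => Fp Gq.
have hF : (a * F <= a * (p + t))%R by rewrite ler_pM2l.
have hG : ((1 - a) * G <= (1 - a) * (q + t))%R by rewrite ler_pM2l ?subr_gt0.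
by lra.
Qed.

End Moreau.

Theorem theorem7p2 (R : realType) (n : nat) (f g : 'rV[R]_n -> \bar R)
    (mu alpha : R)
    (f_proper : proper_fun f) (g_proper : proper_fun g)
    (f_lsc : lower_semicontinuous f) (g_lsc : lower_semicontinuous g)
    (mu_gt0 : (0 < mu)%R)
    (argmin_meet : (argmin f `&` argmin g) !=set0)
    (alpha_gt0 : (0 < alpha)%R) (alpha_lt1 : (alpha < 1)%R) :
  (is_min (wsum alpha f g) (alpha%:E * emin f + (1 - alpha)%:E * emin g) /\
   argmin (wsum alpha f g) = argmin f `&` argmin g) /\
  (is_min (prox_avg mu alpha f g)
     (alpha%:E * emin f + (1 - alpha)%:E * emin g) /\
   argmin (prox_avg mu alpha f g) = argmin f `&` argmin g).
Proof.
have [z [fz gz]] := argmin_meet.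
have ffin := fin_num_argmin f z f_proper fz.
have gfin := fin_num_argmin g z g_proper gz.
rewrite (emin_argmin f z fz) (emin_argmin g z gz).
split; apply: is_min_sublevel => // x.
- exact: wsum_ge.
- split.
    move=> h; have [fxz gxz] := wsum_leP _ _ _ _ _ _ alpha_gt0 alpha_lt1
      ffin gfin (fz x) (gz x) h.
    by split; [exact: (argmin_le f z) | exact: (argmin_le g z)].
  (* Here the right-hand side is read as [wsum] at [z], and the lower bounds [p], [q] are [f x] and
     [g x]. *)
  by move=> [fx gx]; apply: wsum_ge.
- apply: le_trans (prox_avg_ge_wsum_moreau mu mu_gt0 alpha f g z x fz gz _ _) => //.
  by apply: wsum_ge => //; exact: moreau_ge_argmin.
- split.
    move=> h.
    have [efx egx] := wsum_leP _ _ _ _ _ _ alpha_gt0 alpha_lt1 ffin gfin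
      (moreau_ge_argmin mu mu_gt0 f z x fz) (moreau_ge_argmin mu mu_gt0 g z x gz)
      (le_trans (prox_avg_ge_wsum_moreau mu mu_gt0 alpha f g z x fz gz ffin gfin) h).
    by split; [exact: (moreau_le_argmin mu mu_gt0 f z)
              | exact: (moreau_le_argmin mu mu_gt0 g z)].
  move=> [fx gx].
  (* The upper bound is applied with [x] itself as the common minimizer; [wsum] at [x] is then
     compared with its value at [z]. *)
  apply: le_trans (prox_avg_le_wsum_argmin mu mu_gt0 alpha f g x _ _ fx gx _ _) _ => //.
  + exact: fin_num_argmin.
  + exact: fin_num_argmin.
  + by apply: wsum_ge.
Qed.
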